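(* For any $u\in(0,1)$, the range of $F((n-1+u)T;\theta\,|\,D\geqslant 1)$ as a function of $\theta\in(0,\infty)$ is the interval $(u,1)$.
   Context: Type-I censoring with exponential lifetimes: $n\geqslant 1$ is an integer, $T>0$ is fixed, and under $\mathsf P_\theta$, $\theta\in\Theta=(0,\infty)$, the lifetimes $X_1,\ldots,X_n$ are iid exponential random variables with mean $\theta$, with ordered sample $X_{1:n}<\cdots<X_{n:n}$. Let $D=\sum_{i=1}^n I(X_i\leqslant T)$ be the number of failures observed until time $T$. When $D\geqslant 1$, the maximum likelihood estimator of $\theta$ is $$\hat\theta=\frac{\sum_{i=1}^D X_{i:n}+(n-D)T}{D}.$$ $F(y;\theta\,|\,D\geqslant 1)=\mathsf P_\theta(\hat\theta\leqslant y\,|\,D\geqslant 1)$ denotes the conditional CDF of $\hat\theta$ given $D\geqslant 1$; explicitly, for $y>0$, $$F(y;\theta\,|\,D\geqslant 1)=\sum_{d=1}^n\sum_{\nu=0}^d\frac{(-1)^\nu\binom{n}{d}\binom{d}{\nu}}{\mathsf P_\theta(D\geqslant 1)}e^{-(n-d+\nu)T/\theta}\,G\left(\frac{dy-(n-d+\nu)T}{\theta};d\right),$$ where $G(x;d)=\Gamma(d)^{-1}\int_0^x u^{d-1}e^{-u}\,du$ for $x>0$ and $G(x;d)=0$ for $x\leqslant 0$ is the CDF of the gamma distribution with shape $d$ and scale $1$. *)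

(* Defs.v *)
From HB Require Import structures.
From mathcomp Require Import all_boot all_order all_algebra.
From mathcomp Require Import all_classical all_reals all_analysis.
Import Order.TTheory GRing.Theory Num.Theory.
Import numFieldNormedType.Exports.

Set Implicit Arguments.
Unset Strict Implicit.
Unset Printing Implicit Defensive.

Local Open Scope classical_set_scope.
Local Open Scope ring_scope.

Definition mutually_independent (d : measure_display) (Omega : measurableType d)
    (R : realType) (P : probability Omega R) (n : nat)
    (X : 'I_n -> {mfun Omega >-> R}) : Prop :=
  forall (J : {set 'I_n}) (A : 'I_n -> set R),
    (forall i, i \in J -> measurable (A i)) ->
    P (\bigcap_(i in [set` J]) (X i @^-1` A i)) =
      (\prod_(i in J) P (X i @^-1` A i))%E.

(* [exponential_prob] is parameterised by the rate, so mean theta is rate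
   theta^-1. *)
Definition iid_exponential (d : measure_display) (Omega : measurableType d)
    (R : realType) (P : probability Omega R) (n : nat)
    (X : 'I_n -> {mfun Omega >-> R}) (theta : R) : Prop :=
  (forall (i : 'I_n) (A : set R), measurable A ->
     distribution P (X i) A = exponential_prob theta^-1 A) /\
  mutually_independent P X.

(* X_{k:n}, with k counted from 1. *)
Definition order_stat (R : realType) (Omega : Type) (n : nat)
    (X : 'I_n -> Omega -> R) (k : nat) (w : Omega) : R :=
  nth 0 (sort <=%O [seq X i w | i : 'I_n]) k.-1.

Definition failures (R : realType) (Omega : Type) (n : nat)
    (X : 'I_n -> Omega -> R) (T : R) (w : Omega) : nat :=
  (\sum_(i < n) nat_of_bool (X i w <= T)%R)%N.

(* Only meaningful where [failures X T w >= 1]; elsewhere the division by zero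
   yields 0. *)
Definition mle (R : realType) (Omega : Type) (n : nat)
    (X : 'I_n -> Omega -> R) (T : R) (w : Omega) : R :=
  let D := failures X T w in
  (\sum_(1 <= k < D.+1) order_stat X k w + (n - D)%:R * T) / D%:R.

Definition cond_prob (d : measure_display) (Omega : measurableType d)
    (R : realType) (P : probability Omega R) (A B : set Omega) : R :=
  fine (P (A `&` B)) / fine (P B).

Definition mle_cond_cdf (d : measure_display) (Omega : measurableType d)
    (R : realType) (P : probability Omega R) (n : nat)
    (X : 'I_n -> {mfun Omega >-> R}) (T y : R) : R :=
  cond_prob P [set w | mle X T w <= y] [set w | (1 <= failures X T w)%N].

(* Main.v *)
(* With y = (n - 1 + u) T, two or more failures force the estimator below y, so
   given D >= 1 it exceeds y exactly when the only failure lies in (u T, T].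
   Writing s = T / theta and q = e^(- s), the conditional CDF at y is therefore
     1 - n (q^u - q) q^(n - 1) / (1 - q^n).
   The subtracted ratio is below 1 - u because q^u < 1 - u + u q (strict
   convexity of exp) and n q^(n - 1) (1 - q) <= 1 - q^n.  It tends to 1 - u as
   s -> 0 and to 0 as s -> +oo, so by continuity it takes every value in
   (0, 1 - u). *)
Require Import Defs.
From mathcomp Require Import all_boot all_order all_algebra.
From mathcomp Require Import all_classical all_reals all_analysis.
From mathcomp Require Import ring lra.
Import Order.TTheory GRing.Theory Num.Theory.
Import numFieldNormedType.Exports.

Local Open Scope classical_set_scope.
Local Open Scope ring_scope.

(** * Failure counts, order statistics and the event that the estimator is small *)

Section order_statistics.
Context {R : realType} {Omega : Type} {n : nat}.
Implicit Types (X : 'I_n -> Omega -> R) (T : R) (w : Omega).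

Lemma failures_card X T w :
  failures X T w = #|[set i | X i w <= T]%SET|.
Proof.
rewrite /failures -sum1dep_card [RHS]big_mkcond /=.
by apply: eq_bigr => i _; case: (X i w <= T).
Qed.

Lemma failures_le X T w : (failures X T w <= n)%N.
Proof. by rewrite failures_card -[leqRHS]card_ord max_card. Qed.

Lemma failures_gt0 X T w :
  (0 < failures X T w)%N <-> exists i, X i w <= T.
Proof.
rewrite failures_card; split.
  by move=> /card_gt0P[i]; rewrite inE => ?; exists i.
by move=> [i Xi]; apply/card_gt0P; exists i; rewrite inE.
Qed.

(** In the sorted sample the entries at most [T] form an initial segment, whose length is the number
    of failures. *)
Lemma order_stat_leE X T w k : (0 < k <= n)%N ->
  (order_stat X k w <= T) = (k <= failures X T w)%N.
Proof.
move=> /andP[k0 kn].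
have sX := @sort_sorted _ <=%O le_total [seq X i w | i : 'I_n].
have FE : failures X T w =
    count (<= T) (sort <=%O [seq X i w | i : 'I_n]).
  rewrite count_sort count_map -sum1_count big_mkcond /= big_enum /=.
  by rewrite /failures; apply: eq_bigr => i _; case: (X i w <= T).
rewrite /order_stat FE; case: ltnP; last first => kF.
  by rewrite nth_count_le// prednK.
apply/negbTE; rewrite -ltNge; apply: nth_count_gt => //.
by rewrite size_sort size_map size_enum_ord prednK// kn andbT -ltnS prednK.
Qed.

(* Two or more failures force [mle <= n T / 2], which is at most
   [(n - 1) T]. *)
Lemma mle_leE X T u w : 0 < T -> 0 < u -> (0 < failures X T w)%N ->
  (mle X T w <= (n%:R - 1 + u) * T) =
  (1 < failures X T w)%N || (0 < failures X (u * T) w)%N.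
Proof.
move=> T0 u0; have := failures_le X T w.
rewrite /mle; case FE : (failures X T w) => [//|[|D]] Dn _ /=.
  (* With one failure the estimator is the smallest lifetime plus [(n - 1) T], so the bound says
     that this lifetime is at most [u T]. *)
  rewrite big_nat1 divr1 -order_stat_leE// natrB//.
  by rewrite -(lerBrDr); congr (_ <= _); lra.
apply/idP; rewrite ler_pdivrMr//.
have sD : \sum_(1 <= k < D.+3) order_stat X k w <= D.+2%:R * T.
  rewrite (_ : _ * T = \sum_(1 <= k < D.+3) T); last first.
    by rewrite sumr_const_nat subn1 mulr_natl.
  rewrite big_nat_cond [leRHS]big_nat_cond; apply: ler_sum => k.
  rewrite andbT ltnS => /andP[k0 kD].
  by rewrite order_stat_leE ?FE// k0 (leq_trans kD).
rewrite natrB//.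
have n2 : 2 <= n%:R :> R by rewrite ler_nat (leq_trans _ Dn).
have D2 : 2 <= D.+2%:R :> R by rewrite ler_nat.
have : n%:R <= (n%:R - 1) * D.+2%:R :> R by nra.
rewrite -(ler_pM2r T0).
have : 0 < u * T * D.+2%:R by rewrite !mulr_gt0// ltr0n.
nra.
Qed.

End order_statistics.

(** * Analytic bounds and range of the tail ratio *)

Section censored_tail_ratio.
Context {R : realType}.
Variable u : R.
Hypotheses (u_gt0 : 0 < u) (u_lt1 : u < 1).

(** The tangent to exp at [- (u s)] lies strictly below exp at [0] and at [- s]. Averaging these two
    inequalities with weights [1 - u] and [u] cancels the slope terms. *)
Lemma expRN_lt_chord (s : R) : s != 0 ->
  expR (- (u * s)) < 1 - u + u * expR (- s).
Proof.
move=> s0; set m := expR (- (u * s)).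
have m0 : 0 < m := expR_gt0 _.
have e1 : 1 = m * expR (u * s) by rewrite /m expRN mulVf ?gt_eqF ?expR_gt0.
have e2 : expR (- s) = m * expR (- ((1 - u) * s)).
  by rewrite -expRD; congr expR; ring.
have us : u * s != 0 by rewrite mulf_neq0// gt_eqF.
have vs : - ((1 - u) * s) != 0.
  by rewrite oppr_eq0 mulf_neq0// gt_eqF// subr_gt0.
have h1 : m * (1 + u * s) < 1 by rewrite [ltRHS]e1 ltr_pM2l// expR_gt1Dx.
have h2 : m * (1 - (1 - u) * s) < expR (- s).
  by rewrite e2 ltr_pM2l// expR_gt1Dx.
have k1 : 0 < (1 - u) * (1 - m * (1 + u * s)) by rewrite mulr_gt0 ?subr_gt0.
have k2 : 0 < u * (expR (- s) - m * (1 - (1 - u) * s)).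
  by rewrite mulr_gt0 ?subr_gt0.
lra.
Qed.

(** Factor out [1 - q]: each of the [n] terms of the remaining geometric sum lies between
    [q ^+ n.-1] and [1]. *)
Lemma geometric_factor_bounds (n : nat) (q : R) : 0 < q -> q <= 1 ->
  n%:R * q ^+ n.-1 * (1 - q) <= 1 - q ^+ n <= n%:R * (1 - q).
Proof.
move=> q0 q1.
have -> : 1 - q ^+ n = (1 - q) * \sum_(i < n) q ^+ i.
  by rewrite -opprB subrX1 -mulNr opprB.
have sumE (x : R) : n%:R * x = \sum_(i < n) x.
  by rewrite sumr_const card_ord mulr_natl.
apply/andP; split.
  rewrite mulrC ler_wpM2l ?subr_ge0// sumE; apply: ler_sum => i _.
  apply: ler_wiXn2l => //; first exact: ltW.
  by case: n i {sumE} => [|n] [i].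
rewrite mulrC ler_wpM2r ?subr_ge0// -[n%:R]mulr1 sumE; apply: ler_sum => i _.
by rewrite exprn_ile1// ltW.
Qed.

(** With [s = T / theta], this is the conditional probability, given a failure by time [T], that
    there is only one and that it comes after [u T]. *)
Definition tail_ratio (n : nat) (s : R) : R :=
  n%:R * ((expR (- (u * s)) - expR (- s)) * expR (- s) ^+ n.-1) /
  (1 - expR (- s) ^+ n).

Lemma tail_ratio_bounds (n : nat) (s : R) : (0 < n)%N -> 0 < s ->
  0 < tail_ratio n s < 1 - u.
Proof.
move=> n0 s0; rewrite /tail_ratio.
have chord := expRN_lt_chord s (lt0r_neq0 s0).
set q := expR (- s) in chord *; set p := expR _ in chord *.
have q0 : 0 < q := expR_gt0 _.
have q1 : q < 1 by rewrite expR_lt1 oppr_lt0.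
have pq : q < p by rewrite ltr_expR ltrN2 gtr_pMl.
have D0 : 0 < 1 - q ^+ n by rewrite subr_gt0 exprn_ilt1 ?(ltW q0) -?lt0n.
have nR : 0 < n%:R :> R by rewrite ltr0n.
apply/andP; split.
  by rewrite divr_gt0// !mulr_gt0 ?subr_gt0 ?exprn_gt0.
rewrite ltr_pdivrMr//.
have /andP[lo _] := geometric_factor_bounds n q q0 (ltW q1).
(* The chord inequality, rewritten as [p - q < (1 - u) (1 - q)], gives the strict half; the
   geometric lower bound gives the other. *)
apply: (@lt_le_trans _ _ ((1 - u) * (n%:R * q ^+ n.-1 * (1 - q)))); last first.
  by rewrite ler_pM2l ?subr_gt0.
have -> : n%:R * ((p - q) * q ^+ n.-1) = n%:R * q ^+ n.-1 * (p - q) by ring.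
have -> : (1 - u) * (n%:R * q ^+ n.-1 * (1 - q)) =
  n%:R * q ^+ n.-1 * ((1 - u) * (1 - q)) by ring.
by rewrite ltr_pM2l ?mulr_gt0 ?exprn_gt0//; lra.
Qed.

(** An explicit form of the limit [1 - u] at [0]. The numerator is at least [(1 - u) q^n n s] and
    the denominator at most [n s], so the ratio is at least [(1 - u) q^n], and [q^n >= 1 - n s]. *)
Lemma tail_ratio_ge (n : nat) (s : R) : (0 < n)%N -> 0 < s ->
  (1 - u) * (1 - n%:R * s) <= tail_ratio n s.
Proof.
move=> n0 s0; rewrite /tail_ratio.
set p := expR (- (u * s)); set q := expR (- s).
have q0 : 0 < q := expR_gt0 _.
have q1 : q < 1 by rewrite expR_lt1 oppr_lt0.
have D0 : 0 < 1 - q ^+ n by rewrite subr_gt0 exprn_ilt1 ?(ltW q0) -?lt0n.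
have nR : 0 < n%:R :> R by rewrite ltr0n.
have /andP[_ hi] := geometric_factor_bounds n q q0 (ltW q1).
have qs : 1 - q <= s by have := expR_ge1Dx (- s); rewrite -/q; lra.
have pq : q * ((1 - u) * s) <= p - q.
  have -> : p = q * expR ((1 - u) * s).
    by rewrite -expRD; congr expR; ring.
  by have := expR_ge1Dx ((1 - u) * s); nra.
have qn : 1 - n%:R * s <= q ^+ n.
  by rewrite -expRM_natl mulrN; have := expR_ge1Dx (- (n%:R * s)).
have qq : q ^+ n = q * q ^+ n.-1 by rewrite -exprS prednK.
have Q0 : 0 < q ^+ n by rewrite exprn_gt0.
rewrite ler_pdivlMr//.
apply: (@le_trans _ _ ((1 - u) * q ^+ n * (n%:R * s))).
  apply: (@le_trans _ _ ((1 - u) * q ^+ n * (1 - q ^+ n))).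
    by rewrite ler_pM2r// ler_pM2l// subr_gt0.
  rewrite ler_pM2l ?mulr_gt0 ?subr_gt0//; apply: le_trans hi _.
  by rewrite ler_pM2l.
have -> : (1 - u) * q ^+ n * (n%:R * s) =
    n%:R * (q * ((1 - u) * s) * q ^+ n.-1) by rewrite qq; ring.
by rewrite ler_pM2l// ler_pM2r ?exprn_gt0.
Qed.

(** An explicit form of the limit [0] at infinity, from [e^(-x) <= 1 / (1 + x)]. For [s >= 1] this
    gives [q <= 1/2], so the denominator is at least [1/2], while the numerator is at most
    [n p <= n / (1 + u s)]. *)
Lemma tail_ratio_le (n : nat) (s : R) : (0 < n)%N -> 1 <= s ->
  tail_ratio n s <= 2 * n%:R / (1 + u * s).
Proof.
move=> n0 s1; rewrite /tail_ratio.
have s0 : 0 < s := lt_le_trans ltr01 s1.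
set p := expR (- (u * s)); set q := expR (- s).
have q0 : 0 < q := expR_gt0 _.
have p0 : 0 < p := expR_gt0 _.
have inv_expR (x : R) : expR (- x) * (1 + x) <= 1.
  have := expR_ge1Dx x; have := expR_gt0 (- x).
  have : expR (- x) * expR x = 1 by rewrite -expRD addNr expR0.
  by nra.
have q2 : q <= 1 / 2 by have := inv_expR s; rewrite -/q; nra.
have pu : p * (1 + u * s) <= 1 := inv_expR _.
have q1 : q <= 1 by lra.
have nR : 0 < n%:R :> R by rewrite ltr0n.
have Q1 : q ^+ n.-1 <= 1 by rewrite exprn_ile1// ltW.
have Q0 : 0 < q ^+ n.-1 by rewrite exprn_gt0.
have qq : q ^+ n = q * q ^+ n.-1 by rewrite -exprS prednK.
have us : 0 < u * s by rewrite mulr_gt0.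
have D2 : 1 / 2 <= 1 - q ^+ n by rewrite qq; nra.
rewrite ler_pdivrMr ?(lt_le_trans _ D2)// mulrAC ler_pdivlMr ?addr_gt0//.
have num : (p - q) * q ^+ n.-1 * (1 + u * s) <= 1.
  apply: le_trans pu; rewrite ler_pM2r ?addr_gt0//.
  apply: (@le_trans _ _ (p * q ^+ n.-1)); last by rewrite ger_pMr.
  by rewrite ler_pM2r//; lra.
rewrite [leLHS](_ : _ = n%:R * ((p - q) * q ^+ n.-1 * (1 + u * s)));
  last by ring.
rewrite [leRHS](_ : _ = n%:R * (2 * (1 - q ^+ n))); last by ring.
by rewrite ler_pM2l//; lra.
Qed.

Lemma continuous_tail_ratio (n : nat) (s : R) : (0 < n)%N -> 0 < s ->
  {for s, continuous (tail_ratio n)}.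
Proof.
move=> n0 s0.
have cE (c : R) : {for s, continuous (fun x => expR (- (c * x)))}.
  apply: continuous_comp; last exact: continuous_expR.
  by apply: cvgN; apply: cvgMr; exact: cvg_id.
have c1 : {for s, continuous (fun x : R => expR (- x))}.
  apply: continuous_comp; last exact: continuous_expR.
  exact: opp_continuous.
have cX k : {for s, continuous (fun x : R => expR (- x) ^+ k)}.
  apply: (@continuous_comp _ _ _ (fun x : R => expR (- x))
    (fun y => y ^+ k)) => //.
  exact: exprn_continuous.
apply: cvgM.
  apply: cvgMr; apply: cvgM; last exact: cX.
  by apply: cvgB; [exact: cE|exact: c1].
apply: cvgV; last by apply: cvgB; [exact: cvg_cst|exact: cX].
by rewrite gt_eqF// subr_gt0 exprn_ilt1 ?expR_ge0 -?lt0n// expR_lt1 oppr_lt0.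
Qed.

Lemma tail_ratio_surjective (n : nat) (v : R) : (0 < n)%N -> 0 < v < 1 - u ->
  exists2 s, 0 < s & tail_ratio n s = v.
Proof.
move=> n0 /andP[v0 v1].
have nR : 1 <= n%:R :> R by rewrite ler1n.
have nR0 : 0 < n%:R :> R by rewrite ltr0n.
have u1 : 0 < 1 - u by rewrite subr_gt0.
(* The point [a] solves [(1 - u) (1 - n a) = v], so the lower bound at [a] is exactly [v]. The point
   [b] makes the upper bound [2 n / (1 + u b)] at most [v]; its summand [1] ensures [b >= 1], and
   [a <= 1]. *)
pose a := (1 - v / (1 - u)) / n%:R.
pose b := 1 + 2 * n%:R / (u * v).
have vu : v / (1 - u) < 1 by rewrite ltr_pdivrMr// mul1r.
have vu0 : 0 < v / (1 - u) by rewrite divr_gt0.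
have a0 : 0 < a by rewrite divr_gt0// subr_gt0.
have b1 : 1 <= b by rewrite lerDl divr_ge0 ?mulr_ge0 ?ltW.
have ab : a <= b.
  apply: le_trans b1; rewrite ler_pdivrMr//; lra.
have ra : v <= tail_ratio n a.
  apply: le_trans (tail_ratio_ge _ _ n0 a0); rewrite /a mulrC.
  rewrite le_eqVlt; apply/orP; left; apply/eqP.
  by field; rewrite !gt_eqF.
have rb : tail_ratio n b <= v.
  apply: le_trans (tail_ratio_le _ _ n0 b1) _.
  have ub : 0 < 1 + u * b by rewrite addr_gt0 ?mulr_gt0// (lt_le_trans ltr01).
  rewrite ler_pdivrMr//.
  have -> : v * (1 + u * b) = v + u * v + 2 * n%:R.
    by rewrite /b; field; rewrite !gt_eqF.
  by rewrite lerDr addr_ge0 ?mulr_ge0 ?ltW.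
have [||s] := @IVT _ (tail_ratio n) a b v ab.
- apply: continuous_in_subspaceT => x /set_mem /=.
  rewrite in_itv/= => /andP[ax _]; apply: continuous_tail_ratio => //.
  exact: lt_le_trans ax.
- by rewrite ge_min le_max ra rb orbT.
rewrite in_itv/= => /andP[as_ _] sv; exists s => //.
exact: lt_le_trans as_.
Qed.

End censored_tail_ratio.

(** * Exponential lifetimes and the conditional law of the estimator *)

Lemma exponential_prob_nonneg (R : realType) (rate : R) (V : set R) :
  exponential_prob rate (V `&` `[0, +oo[) = exponential_prob rate V.
Proof.
rewrite /exponential_prob /exponential_pdf.
rewrite [LHS]integral_mkcondr; apply: eq_integral => x _.
by rewrite /patch/=; case: (x \in _).
Qed.

Section type_I_censoring.
Context {R : realType} {d : measure_display} {Omega : measurableType d}.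
Context {n : nat} (P : probability Omega R) (X : 'I_n -> {mfun Omega >-> R}).
Variable theta : R.
Hypothesis theta_gt0 : 0 < theta.
Hypothesis X_iid : iid_exponential P X theta.

Lemma prob_lifetime_gt (i : 'I_n) (a : R) : 0 < a ->
  P (X i @^-1` `]a, +oo[) = (expR (- (a / theta)))%:E.
Proof.
move=> a0; have [dX _] := X_iid.
have -> : P (X i @^-1` `]a, +oo[) = distribution P (X i) (~` `]-oo, a]).
  by rewrite setCitvl.
(* The density vanishes on the negative reals, so the half-line may be cut down to [[0, a]], whose
   probability has a closed form. *)
rewrite probability_setC//= dX// -exponential_prob_nonneg.
have -> : `]-oo, a] `&` `[0, +oo[ = `[0, a]%classic.
  by apply/seteqP; split => x /=; rewrite !in_itv/= andbT andbC => /andP.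
rewrite exponential_prob_itv0c// -[1%E]/(1%:E) -!EFinB; congr EFin.
by rewrite opprB addrC subrK mulNr mulrC.
Qed.

Lemma prob_lifetime_itv (i : 'I_n) (a b : R) : 0 < a -> a <= b ->
  P (X i @^-1` `]a, b]) = (expR (- (a / theta)) - expR (- (b / theta)))%:E.
Proof.
move=> a0 ab; rewrite EFinB -(prob_lifetime_gt i a)//.
rewrite -(prob_lifetime_gt i b) ?(lt_le_trans a0 ab)//.
have -> : X i @^-1` `]a, b] = X i @^-1` `]a, +oo[ `\` X i @^-1` `]b, +oo[.
  apply/seteqP; split => w /=; rewrite !in_itv/= !andbT.
    by move=> /andP[-> ?]; split=> //; apply/negP; rewrite -leNgt.
  by move=> [-> /negP]; rewrite -leNgt.
have mX c : measurable (X i @^-1` `]c, +oo[).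
  by rewrite -[_ @^-1` _]setTI; exact: measurable_funPT.
rewrite measureD ?ltey_eq ?fin_num_measure//.
congr (_ - P _)%E; apply/seteqP; split => w /=; rewrite !in_itv/= !andbT.
  by case.
by move=> bw; split => //; exact: le_lt_trans bw.
Qed.

Lemma prob_lifetimes (A : 'I_n -> set R) (p : 'I_n -> R) :
  (forall i, measurable (A i)) ->
  (forall i, P (X i @^-1` A i) = (p i)%:E) ->
  P (\bigcap_i (X i @^-1` A i)) = (\prod_i p i)%:E.
Proof.
move=> mA pA; have [_ indep] := X_iid.
rewrite -prodEFin -(eq_bigr _ (fun i _ => pA i)).
have := indep [set: 'I_n]%SET A (fun i _ => mA i).
rewrite (_ : [set` [set: 'I_n]%SET] = [set: 'I_n]); last first.
  by apply/seteqP; split => // i _ /=; rewrite inE.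
by move=> ->; apply: eq_bigl => i; rewrite inE.
Qed.

Variables (T u : R).
Hypotheses (T_gt0 : 0 < T) (u_gt0 : 0 < u) (u_lt1 : u < 1).

(** For [a > 0], the probability that a lifetime exceeds [a T]. *)
Let q (a : R) := expR (- (a * (T / theta))).

Lemma prob_failures_ge1 :
  P [set w | (0 < failures X T w)%N] = (1 - q 1 ^+ n)%:E.
Proof.
pose S := \bigcap_i (X i @^-1` `]T, +oo[).
have mS : measurable S.
  apply: fin_bigcap_measurable => // i _.
  by rewrite -[_ @^-1` _]setTI; exact: measurable_funPT.
rewrite (_ : [set w | _] = ~` S); last first.
  rewrite -[LHS]setCK; congr (~` _); apply/seteqP; split => w /=.
    move=> nF i _ /=; rewrite in_itv/= andbT ltNge; apply/negP => XT.
    by apply: nF; apply/failures_gt0; exists i.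
  move=> Sw /failures_gt0[i]; have := Sw i I.
  by rewrite /= in_itv/= andbT ltNge => /negP.
rewrite probability_setC// (prob_lifetimes _ (fun=> q 1))//.
  by rewrite prodr_const card_ord.
by move=> i; rewrite prob_lifetime_gt// /q mul1r.
Qed.

(** Sides of a product box: lifetime [i] is the only failure and comes after [u T]. The exceptional
    event is a union of such boxes, and independence gives the probability of each. *)
Let single (i j : 'I_n) : set R :=
  if j == i then `]u * T, T]%classic else `]T, +oo[%classic.

Let measurable_single i : measurable (\bigcap_j (X j @^-1` single i j)).
Proof.
apply: fin_bigcap_measurable => // j _; rewrite -[_ @^-1` _]setTI.
by apply: measurable_funPT => //; rewrite /single; case: ifP.
Qed.

Lemma prob_single (i : 'I_n) :
  P (\bigcap_j (X j @^-1` single i j)) =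
  ((q u - q 1) * q 1 ^+ n.-1)%:E.
Proof.
rewrite (prob_lifetimes _ (fun j => if j == i then q u - q 1 else q 1)).
- rewrite (bigD1 i)//= eqxx; congr (_ * _)%:E.
  rewrite (eq_bigr (fun=> q 1)); last by move=> j /negbTE ->.
  by rewrite prodr_const cardC1 card_ord.
- by move=> j; rewrite /single; case: ifP.
- move=> j; rewrite /single; case: ifP => _.
    rewrite prob_lifetime_itv ?mulr_gt0// ?ger_pMl ?(ltW u_lt1)//.
    by rewrite /q mul1r mulrA.
  by rewrite prob_lifetime_gt// /q mul1r.
Qed.

(** By [mle_leE], once a failure occurs the inequality breaks exactly when there is no second
    failure and none by [u T]; the index of the sole failure selects the box. *)
Lemma mle_le_failures_ge1 :
  [set w | mle X T w <= (n%:R - 1 + u) * T] `&`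
    [set w | (0 < failures X T w)%N] =
  [set w | (0 < failures X T w)%N] `\`
    \bigcup_i \bigcap_j (X j @^-1` single i j).
Proof.
have uT : u * T <= T by rewrite ger_pMl ?(ltW u_lt1).
apply/seteqP; split => w /=.
  move=> [+ F0]; rewrite mle_leE// => FF; split => // -[i _ si].
  have XuT j : u * T < X j w.
    have := si j I; rewrite /single/=; case: ifP => _ /=; rewrite in_itv/=.
      by move=> /andP[].
    by rewrite andbT; exact: le_lt_trans.
  case/orP: FF => [|/failures_gt0[j]]; last by rewrite leNgt XuT.
  rewrite failures_card => /card_gt1P[j [k [+ + jk]]].
  rewrite !inE => jT kT.
  (* In box [i] every other lifetime exceeds [T], so two distinct failures are impossible. *)
  have onlyi l : X l w <= T -> l = i.
    have := si l I; rewrite /single/=; case: eqP => // _ /=.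
    by rewrite in_itv/= andbT leNgt => ->.
  by move: jk; rewrite (onlyi _ jT) (onlyi _ kT) eqxx.
move=> [F0 ns]; split => //; rewrite mle_leE//; apply/negP => /negP.
rewrite negb_or -leqNgt => /andP[F1 /negP Fu]; apply: ns.
have /cards1P[i Fi] : #|[set i | X i w <= T]%SET| == 1%N.
  by rewrite -(failures_card (fun i => X i)) eqn_leq F1.
have XT j : (X j w <= T) = (j == i).
  by move/setP/(_ j): Fi; rewrite !inE.
exists i => // j _; rewrite /single/=; case: eqP => [->|ji] /=.
  rewrite in_itv/= XT eqxx andbT ltNge; apply/negP => Xu.
  by apply/Fu/failures_gt0; exists i.
by rewrite in_itv/= andbT ltNge XT; apply/negP => /eqP.
Qed.

(** The [n] boxes are equally likely, lie inside the conditioning event, and are disjoint because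
    lifetime [i] is at most [T] in box [i] and exceeds [T] in every other box. Their union thus has
    [n] times the probability of one box. *)
Lemma mle_cond_cdfE : (0 < n)%N ->
  mle_cond_cdf P X T ((n%:R - 1 + u) * T) =
  1 - tail_ratio u n (T / theta).
Proof.
move=> n0.
rewrite /mle_cond_cdf /cond_prob mle_le_failures_ge1.
set B := [set w | _]; pose V i := \bigcap_j (X j @^-1` single i j).
set U := \bigcup_i _; rewrite -/V in U *.
have PB : P B = (1 - q 1 ^+ n)%:E := prob_failures_ge1.
have q1 : q 1 < 1 by rewrite expR_lt1 oppr_lt0 mul1r divr_gt0.
have B0 : 0 < 1 - q 1 ^+ n.
  by rewrite subr_gt0 exprn_ilt1 ?expR_ge0// -lt0n.
have mB : measurable B.
  have -> : B = \bigcup_i (X i @^-1` `]-oo, T]).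
    apply/seteqP; split => w /=.
      by move/failures_gt0 => [i ?]; exists i => //=; rewrite in_itv.
    by move=> [i _ /=]; rewrite in_itv/= => ?; apply/failures_gt0; exists i.
  apply: fin_bigcup_measurable => // i _.
  by rewrite -[_ @^-1` _]setTI; exact: measurable_funPT.
have mU : measurable U by apply: fin_bigcup_measurable.
have UB : U `<=` B.
  move=> w [i _ /(_ i I)]; rewrite /single eqxx/= in_itv/= => /andP[_ XT].
  by apply/failures_gt0; exists i.
have PU : P U = (n%:R * ((q u - q 1) * q 1 ^+ n.-1))%:E.
  rewrite /U (_ : [set: 'I_n] = [set` [set: 'I_n]%SET]); last first.
    by apply/seteqP; split => // i _ /=; rewrite inE.
  rewrite bigcup_pred measure_bigsetU_ord//.
    rewrite (eq_bigr (fun=> ((q u - q 1) * q 1 ^+ n.-1)%:E)); last first.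
      by move=> i _; exact: prob_single.
    by rewrite sumEFin sumr_const cardsT card_ord mulr_natl.
  apply/trivIsetP => i k _ _ ik; apply/seteqP; split => w //= [wi wk].
  have := wi i I; have := wk i I; rewrite /single eqxx (negbTE ik)/=.
  by rewrite !in_itv/= andbT => Tw /andP[_]; rewrite leNgt Tw.
have -> : P (B `\` U) = (P B - P U)%E.
  by rewrite measureD ?ltey_eq ?fin_num_measure// setIidr.
by rewrite PB PU -EFinB/= mulrBl divff ?gt_eqF// /tail_ratio /q !mul1r.
Qed.

End type_I_censoring.

Theorem corollary1 (R : realType) (d : measure_display)
    (Omega : measurableType d) (n : nat) (T : R)
    (P : R -> probability Omega R) (X : 'I_n -> {mfun Omega >-> R})
    (n_ge1 : (1 <= n)%N) (T_gt0 : 0 < T)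
    (X_iid : forall theta : R, 0 < theta -> iid_exponential (P theta) X theta)
    (u : R) (u_gt0 : 0 < u) (u_lt1 : u < 1) :
  [set mle_cond_cdf (P theta) X T ((n%:R - 1 + u) * T) |
     theta in `]0, +oo[%classic] = `]u, 1[%classic.
Proof.
apply/seteqP; split => v /=.
  move=> [theta]; rewrite in_itv/= andbT => theta0 <-.
  rewrite (mle_cond_cdfE _ _ theta)//; last exact: X_iid.
  have := tail_ratio_bounds u u_gt0 u_lt1 n (T / theta) n_ge1
    (divr_gt0 T_gt0 theta0).
  by move=> /andP[? ?]; rewrite in_itv/=; apply/andP; split; lra.
rewrite in_itv/= => /andP[uv v1].
have compl_v : 0 < 1 - v < 1 - u by apply/andP; split; lra.
have [s s0 sv] := tail_ratio_surjective u u_gt0 u_lt1 n (1 - v) n_ge1 compl_v.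
(* The ratio depends on [theta] only through [T / theta], which equals [s] for this mean. *)
exists (T / s); first by rewrite in_itv/= andbT divr_gt0.
rewrite (mle_cond_cdfE _ _ (T / s)) ?divr_gt0//.
  by rewrite invf_div mulrC divfK ?gt_eqF// sv; lra.
by apply: X_iid; rewrite divr_gt0.
Qed.
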